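(* Let $m\ge n$, let $D,T\in\mathbb{R}^{m\times n}$ with $D$ of full column rank $n$, and put $A=D^TD$, $B=T^TT$. Let $\Phi(X)=\operatorname{tr}(AX+X^{-1}B)$ for $X$ in the set of symmetric positive definite matrices in $\mathbb{R}^{n\times n}$. If $X^{\ast}\in\mathbb{R}^{n\times n}$ is a symmetric positive definite matrix satisfying the first order necessary (KKT) condition $X^{\ast}AX^{\ast}=B$, then $X^{\ast}$ is the unique global minimizer of $\Phi$ over the set of symmetric positive definite matrices in $\mathbb{R}^{n\times n}$.
   Context: The minimization problem is $\min \operatorname{tr}(AX+X^{-1}B)$ over symmetric positive definite $X\in\mathbb{R}^{n\times n}$. Up to the additive constant $-2\operatorname{tr}(T^TD)$, its objective equals $\operatorname{tr}((DX-T)^T(D-TX^{-1}))$. The first order necessary (KKT) conditions of this problem amount to the matrix equation $XAX=B$. *)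

(* Defs.v *)
From mathcomp Require Export all_boot all_order all_algebra.
From mathcomp Require Export classical_sets reals.

Set Implicit Arguments.
Unset Strict Implicit.
Unset Printing Implicit Defensive.

Import Order.TTheory GRing.Theory Num.Theory.

Local Open Scope ring_scope.

Definition posdef_sym (R : realType) (n : nat) : set 'M[R]_n :=
  [set X | X \is symmetricmx /\
     forall v : 'cV[R]_n, v != 0 -> 0 < (v^T *m X *m v) 0 0]%classic.
Arguments posdef_sym : clear implicits.

(* On [posdef_sym R n] every matrix is in [unitmx], so [invmx] is the genuine
   inverse there. *)
Definition Phi (R : realType) (n : nat) (A B : 'M[R]_n) (X : 'M[R]_n) : R :=
  \tr (A *m X + invmx X *m B).

Definition global_minimizer (R : realType) (T : Type) (S : set T) (f : T -> R)
    (x : T) : Prop :=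
  S x /\ forall y, S y -> f x <= f y.

(* Main.v *)
Require Import Defs.
From mathcomp Require Import ring.

Import Order.TTheory GRing.Theory Num.Theory.

Local Open Scope ring_scope.

(** With [E = X - Xs], the condition [Xs A Xs = B] turns [Phi X - Phi Xs] into
    [tr (A E X^-1 E) = tr (W^T X W)], where [W = X^-1 E D^T].  This is a sum
    of values of the positive definite form [X] at the columns of [W]; it
    vanishes only if [W = 0], and then [E = 0] since [D] has full column
    rank. *)

Lemma posdef_sym_tr {R : realType} {n : nat} {X : 'M[R]_n} :
  posdef_sym R n X -> X^T = X.
Proof. by case=> /is_hermitianmxP; rewrite expr0 scale1r map_mx_id // => symX _. Qed.

(** A row [v] with [v *m X = 0] makes the quadratic form vanish at [v^T], so [v = 0]. *)
Lemma posdef_sym_unitmx {R : realType} {n : nat} {X : 'M[R]_n} :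
  posdef_sym R n X -> X \in unitmx.
Proof.
move=> [_ posX]; rewrite -row_free_unit; apply: inj_row_free => v vX0.
apply/eqP; apply: contraT => v_neq0; have := posX v^T.
by rewrite trmx_eq0 trmxK vX0 mul0mx mxE ltxx => /(_ v_neq0).
Qed.

(** Lets definiteness of [X], a property of single vectors, act on the trace one column of [W] at a
    time. *)
Lemma congr_mx_diag {R : realType} {m n : nat} (X : 'M[R]_n)
    (W : 'M[R]_(n, m)) (i : 'I_m) :
  (W^T *m X *m W) i i = ((col i W)^T *m X *m col i W) 0 0.
Proof.
by rewrite tr_col -row_mul !mxE; apply: eq_bigr => k _; rewrite !mxE.
Qed.

Lemma posdef_sym_congr_diag_ge0 {R : realType} {m n : nat} (X : 'M[R]_n)
    (W : 'M[R]_(n, m)) (i : 'I_m) :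
  posdef_sym R n X -> 0 <= (W^T *m X *m W) i i.
Proof.
move=> [_ posX]; rewrite congr_mx_diag.
have [->|/posX/ltW//] := eqVneq (col i W) 0.
by rewrite mulmx0 mxE.
Qed.

Lemma posdef_sym_congr_trace_ge0 {R : realType} {m n : nat} (X : 'M[R]_n)
    (W : 'M[R]_(n, m)) :
  posdef_sym R n X -> 0 <= \tr (W^T *m X *m W).
Proof. by move=> pX; apply: sumr_ge0 => i _; apply: posdef_sym_congr_diag_ge0. Qed.

(** The trace is a sum of nonnegative terms; if it is zero, the form vanishes at each column of [W],
    which forces that column to be zero. *)
Lemma posdef_sym_congr_trace_eq0 {R : realType} {m n : nat} {X : 'M[R]_n}
    {W : 'M[R]_(n, m)} :
  posdef_sym R n X -> \tr (W^T *m X *m W) = 0 -> W = 0.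
Proof.
move=> pX /eqP; rewrite psumr_eq0 => [/allP tr0|i _]; last first.
  exact: posdef_sym_congr_diag_ge0.
apply/matrixP => j i; suff /matrixP/(_ j 0): col i W = 0 by rewrite !mxE.
apply/eqP; apply: contraT => /(proj2 pX).
by rewrite -congr_mx_diag (eqP (tr0 i (mem_index_enum i))) ltxx.
Qed.

Lemma Phi_sub {R : realType} {m n : nat} {D : 'M[R]_(m, n)} {A B X Xs : 'M[R]_n} :
  A = D^T *m D -> posdef_sym R n X -> posdef_sym R n Xs ->
  Xs *m A *m Xs = B ->
  let W := invmx X *m (X - Xs) *m D^T in
  Phi A B X - Phi A B Xs = \tr (W^T *m X *m W).
Proof.
move=> defA pX pXs <- W.
have uX := posdef_sym_unitmx pX; have uXs := posdef_sym_unitmx pXs.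
(* By symmetry [W^T X W = D E X^-1 E D^T]; cycling [D^T] to the front produces [A]. *)
have -> : \tr (W^T *m X *m W) = \tr (A *m ((X - Xs) *m invmx X *m (X - Xs))).
  rewrite /W !trmx_mul trmxK trmx_inv linearB /= !posdef_sym_tr // !mulmxA.
  by rewrite mulmxKV // mxtrace_mulC defA !mulmxA.
have trX : \tr (invmx X *m (Xs *m A *m Xs)) = \tr (A *m Xs *m invmx X *m Xs).
  by rewrite -(mulmxA (A *m Xs)) [RHS]mxtrace_mulC !mulmxA.
have trXs : \tr (invmx Xs *m (Xs *m A *m Xs)) = \tr (A *m Xs).
  by rewrite !mulmxA mulVmx // mul1mx.
(* Expands [E X^-1 E] to [X - 2 Xs + Xs X^-1 Xs]; both sides are then the same combination of
   traces. *)
rewrite /Phi !mxtraceD trX trXs mulmxBl mulmxV // mulmxBr mulmxBl mul1mx.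
rewrite mulmxBl mul1mx mulmxKV // !mulmxBr !linearB /= !mulmxA.
by ring.
Qed.

Theorem corollary3p1 (R : realType) (m n : nat) (hmn : (n <= m)%N)
    (D T : 'M[R]_(m, n)) (hD : \rank D = n)
    (A B : 'M[R]_n) (hA : A = D^T *m D) (hB : B = T^T *m T)
    (Xs : 'M[R]_n) (hXs : posdef_sym R n Xs)
    (hKKT : Xs *m A *m Xs = B) :
  unique (global_minimizer (posdef_sym R n) (Phi A B)) Xs.
Proof.
have min_Xs X : posdef_sym R n X -> Phi A B Xs <= Phi A B X.
  move=> pX; rewrite -subr_ge0 (Phi_sub hA pX hXs hKKT).
  exact: posdef_sym_congr_trace_ge0.
split=> // X [pX min_X]; have uX := posdef_sym_unitmx pX.
have /eqP : Phi A B X = Phi A B Xs by apply/le_anti; rewrite min_X // min_Xs.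
rewrite -subr_eq0 (Phi_sub hA pX hXs hKKT) => /eqP.
move=> /(posdef_sym_congr_trace_eq0 pX) W0.
have fullD : row_full D by rewrite /row_full hD.
(* This product is [X *m W]. *)
have: (X - Xs) *m D^T = 0.
  by rewrite -[LHS](mulKVmx uX) [invmx X *m _]mulmxA W0 mulmx0.
(* Transposing puts [D] on the left, where full column rank allows it to be cancelled. *)
move=> /(congr1 trmx); rewrite trmx_mul trmxK trmx0 -[RHS](mulmx0 _ D).
move=> /(row_full_inj fullD) /(congr1 trmx).
by rewrite trmxK trmx0 => /subr0_eq.
Qed.
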